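(* Let $t$ and $k$ be positive integers with $k\le 2t-1$. If $G$ is the line graph of a graph $H$ with minimum degree $\delta(H)\ge 2t$, then $\mathrm{a}_k(G)\le \mathrm{a}_k'(G)\le k$ and $\mathrm{b}_k(G)\ge \mathrm{b}_k'(G)\ge k+1$.
   Context: Graphs are finite, simple and undirected. The line graph $L(H)$ of $H$ has the edges of $H$ as vertices, two of them being adjacent iff the corresponding edges share a vertex in $H$. For positive integers $a,b$, the $(a,b)$-biased Maker-Breaker domination game on a graph $G$ is played by Dominator and Staller, who move alternately; on each move Dominator selects $a$ unplayed vertices and Staller selects $b$ unplayed vertices (if fewer unplayed vertices remain than the player's bias, the player selects all remaining ones). Dominator wins if the vertices he selected during the game form a dominating set of $G$; otherwise Staller wins, equivalently, Staller wins iff she claims all vertices of the closed neighborhood of some vertex. In the D-game Dominator moves first; in the S-game Staller moves first. Let $W(G,a,b)\in\{D,S\}$ (resp. $W'(G,a,b)\in\{D,S\}$) denote the winner of the $(a,b)$-biased D-game (resp. S-game) under optimal play, with $D$ standing for Dominator and $S$ for Staller. For a positive integer $\ell$ the thresholds, with minima over positive integers and value $\infty$ if the minimum does not exist, are $\mathrm{a}_\ell(G)=\min\{a: W(G,a,\ell)=D\}$, $\mathrm{a}'_\ell(G)=\min\{a: W'(G,a,\ell)=D\}$, $\mathrm{b}_\ell(G)=\min\{b: W(G,\ell,b)=S\}$, $\mathrm{b}'_\ell(G)=\min\{b: W'(G,\ell,b)=S\}$. *)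

(* Defs.v *)
From mathcomp Require Import all_boot.
From mathcomp Require Import boolp.

Set Implicit Arguments.
Unset Strict Implicit.
Unset Printing Implicit Defensive.

Record sgraph := SGraph {
  vertex :> finType;
  adj : rel vertex;
  adj_sym : symmetric adj;
  adj_irrefl : irreflexive adj }.

Definition degree (G : sgraph) (v : G) : nat := #|[set w | adj v w]|.

(* Every degree is below #|G|, so the default value #|G| never affects the
   minimum of a nonempty graph; the graph without vertices gets the value 0. *)
Definition min_degree (G : sgraph) : nat :=
  \big[minn/#|G|]_(v : G) degree v.

Definition edges (G : sgraph) : {set {set G}} :=
  [set [set p.1; p.2] | p in [set p : G * G | adj p.1 p.2]].

Definition line_vertex (H : sgraph) : finType := {A : {set H} | A \in edges H}.

Definition line_adj (H : sgraph) : rel (line_vertex H) :=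
  fun A B => (A != B) && (val A :&: val B != set0).

Lemma line_adj_sym (H : sgraph) : symmetric (@line_adj H).
Proof. by move=> A B; rewrite /line_adj eq_sym setIC. Qed.

Lemma line_adj_irrefl (H : sgraph) : irreflexive (@line_adj H).
Proof. by move=> A; rewrite /line_adj eqxx. Qed.

Definition line_graph (H : sgraph) : sgraph :=
  SGraph (@line_adj_sym H) (@line_adj_irrefl H).

Definition dominating (G : sgraph) (D : {set G}) : Prop :=
  forall v : G, v \in D \/ exists2 u, u \in D & adj u v.

Inductive player := Dominator | Staller.

(* In a position (D, S), D and S are the sets of vertices selected so far by
   Dominator and by Staller. *)
Definition unplayed (G : sgraph) (D S : {set G}) : {set G} := ~: (D :|: S).

Definition legal_move (G : sgraph) (bias : nat) (D S M : {set G}) : Prop :=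
  M \subset unplayed D S /\ #|M| = minn bias #|unplayed D S|.

(* Dominator can force a win from (D, S) when the given player is to move.
   The least fixed point is backward induction on the finite game. *)
Inductive dominator_wins (G : sgraph) (a b : nat) :
    player -> {set G} -> {set G} -> Prop :=
  | DW_end p D S :
      unplayed D S = set0 -> dominating D -> dominator_wins a b p D S
  | DW_Dominator D S M :
      unplayed D S <> set0 -> legal_move a D S M ->
      dominator_wins a b Staller (D :|: M) S ->
      dominator_wins a b Dominator D S
  | DW_Staller D S :
      unplayed D S <> set0 ->
      (forall M, legal_move b D S M ->
         dominator_wins a b Dominator D (S :|: M)) ->
      dominator_wins a b Staller D S.

(* For positive biases every play ends, and without a draw, so Staller wins
   exactly when Dominator cannot force a win. *)
Definition winner (first : player) (G : sgraph) (a b : nat) : player :=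
  if `[< @dominator_wins G a b first set0 set0 >] then Dominator else Staller.

Definition W : sgraph -> nat -> nat -> player := winner Dominator.
Definition W' : sgraph -> nat -> nat -> player := winner Staller.

(* Extended naturals: None is infinity. *)
Definition natinf := option nat.

Definition le_inf (x y : natinf) : bool :=
  match x, y with
  | _, None => true
  | None, Some _ => false
  | Some m, Some n => m <= n
  end.

Definition min_pos (P : nat -> Prop) : natinf :=
  if pselect (exists n, (0 < n) && `[< P n >]) is left exP
  then Some (ex_minn exP) else None.

Definition thr_a (l : nat) (G : sgraph) : natinf :=
  min_pos (fun a => W G a l = Dominator).
Definition thr_a' (l : nat) (G : sgraph) : natinf :=
  min_pos (fun a => W' G a l = Dominator).
Definition thr_b (l : nat) (G : sgraph) : natinf :=
  min_pos (fun b => W G l b = Staller).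
Definition thr_b' (l : nat) (G : sgraph) : natinf :=
  min_pos (fun b => W' G l b = Staller).

(* Main.v *)
(* Orient H so that every vertex is the tail of at least t edges; Staller, who
   claims at most 2t - 1 edges per move, cannot claim two such out-stars in one
   move.  After each of his moves Dominator keeps every vertex v safe: Staller
   has nothing in the out-star of v, or all edges of H at v are dominated.  To
   each edge e that Staller claims he replies in the out-star of the tail of e
   if he can, else at the tail of e, else in the out-star of the head of e.
   Were safety lost at v, some undominated edge vw would have all of the
   out-stars of v and w claimed in a single move of Staller.
   The D-game is no harder than the S-game, since an extra move never harms
   Dominator. *)
Require Import Defs.
From mathcomp Require Import all_boot.
From mathcomp Require Import boolp zify.

Set Implicit Arguments.
Unset Strict Implicit.
Unset Printing Implicit Defensive.

(** * Padding to legal moves, and monotonicity of the game *)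

Lemma subset_extend_card (T : finType) (P U : {set T}) (n : nat) :
  P \subset U -> #|P| <= n ->
  exists N : {set T}, [/\ P \subset N, N \subset U & #|N| = minn n #|U|].
Proof.
move=> PU; have := subset_leq_card PU.
elim: n => [|n IHn] leU leP.
  by exists P; split=> //; move: leP; rewrite min0n leqn0 => /eqP.
case: (ltnP n #|P|) => [ltnP|lePn].
  by exists P; split=> //; rewrite (minn_idPl _); lia.
have [N [PN NU cN]] := IHn leU lePn.
case: (leqP #|U| n) => [leUn|ltnU].
  by exists N; split=> //; rewrite cN; lia.
have /card_gt0P[x] : 0 < #|U :\: N|.
  by have := cardsID N U; rewrite (setIidPr NU); lia.
rewrite inE => /andP[xN xU]; exists (x |: N); split.
- exact: subset_trans PN (subsetUr _ _).
- by rewrite subUset sub1set xU.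
- by rewrite cardsU1 xN cN; lia.
Qed.

Section Game.

Variable G : sgraph.
Implicit Types D S M N P : {set G}.

Lemma legal_move_extend n D S P :
  P \subset unplayed D S -> #|P| <= n ->
  exists2 N : {set G}, P \subset N & legal_move n D S N.
Proof. by move=> PU /(subset_extend_card PU)[N [? ? ?]]; exists N. Qed.

Lemma dominating_sub D D' : D \subset D' -> dominating D -> dominating D'.
Proof.
move=> DD' dD v; have [vD|[u uD uv]] := dD v.
  by left; apply: (subsetP DD').
by right; exists u => //; apply: (subsetP DD').
Qed.

Lemma unplayedUl D S M : unplayed (D :|: M) S = unplayed D S :\: M.
Proof. by apply/setP=> x; rewrite !inE; do 3!case: (_ \in _). Qed.

Lemma unplayedUr D S M : unplayed D (S :|: M) = unplayed D S :\: M.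
Proof. by apply/setP=> x; rewrite !inE; do 3!case: (_ \in _). Qed.

Lemma legal_move_decr n D S M : 0 < n -> unplayed D S <> set0 ->
  legal_move n D S M -> #|unplayed D S :\: M| < #|unplayed D S|.
Proof.
move=> n_gt0 /eqP; rewrite -card_gt0 => U_gt0 [MU cM].
by have := cardsID M (unplayed D S); rewrite (setIidPr MU) cM; lia.
Qed.

Variables a b : nat.
Hypotheses (a_gt0 : 0 < a) (b_gt0 : 0 < b).

(** Domination persists as Dominator's set grows, and positive biases make every move shrink the
    unplayed set, so the play ends. *)
Lemma dominating_wins p D S : dominating D -> dominator_wins a b p D S.
Proof.
have [n] := ubnP #|unplayed D S|; elim: n p D S => // n IHn p D S ltn domD.
have [U0|/eqP U0] := eqVneq (unplayed D S) set0; first exact: DW_end.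
case: p.
  have [|M _ lM] := @legal_move_extend a D S set0 (sub0set _).
    by rewrite cards0.
  apply: (DW_Dominator U0 lM); apply: IHn.
    by rewrite unplayedUl; have := legal_move_decr a_gt0 U0 lM; lia.
  exact: dominating_sub (subsetUl _ _) domD.
apply: DW_Staller => // M lM; apply: IHn => //.
by rewrite unplayedUr; have := legal_move_decr b_gt0 U0 lM; lia.
Qed.

(** On a full board only [DW_end] applies, and it ignores who is to move. *)
Lemma wins_end p q D S : unplayed D S = set0 ->
  dominator_wins a b p D S -> dominator_wins a b q D S.
Proof. by move=> U0 w; case: w U0 => // ? ? ? ? ? ?; apply: DW_end. Qed.

(* Dominator follows the strategy of (D, S) in (D', S'), keeping the imagined
   position dominated by the real one and playing surplus vertices anywhere. *)
Lemma wins_mono p D S D' S' : D \subset D' -> S' \subset S ->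
  dominator_wins a b p D S -> dominator_wins a b p D' S'.
Proof.
move=> + + w; elim: w D' S' => {p D S}.
- move=> p D S _ domD D' S' DD' _.
  exact/dominating_wins/(dominating_sub DD').
- move=> D S M U0 [MU cM] _ IH D' S' /subsetP DD' /subsetP SS'.
  have MU' : M :\: D' \subset unplayed D' S'.
    apply/subsetP=> x; rewrite !inE => /andP[xD' /(subsetP MU)].
    rewrite !inE !negb_or xD' => /andP[_]; exact: contra (SS' x).
  have cM' : #|M :\: D'| <= a.
    by apply: leq_trans (subset_leq_card (subsetDl _ _)) _; rewrite cM geq_minl.
  have [M' /subsetP MM' lM'] := legal_move_extend MU' cM'.
  have wM' : dominator_wins a b Staller (D' :|: M') S'.
    apply: IH; last exact/subsetP.
    apply/subsetP=> x; rewrite !inE => /orP[/DD'-> //|xM].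
    by have := MM' x; rewrite !inE xM andbT; case: (_ \in D') => //= ->.
  (* The real board may be full before the imagined one; then [M'] is empty and only the player to
     move changes. *)
  have [U0'|/eqP U0'] := eqVneq (unplayed D' S') set0; last exact: DW_Dominator wM'.
  move: lM' wM' => [+ _]; rewrite U0' subset0 => /eqP->; rewrite setU0.
  exact: wins_end.
- move=> D S U0 _ IH D' S' /subsetP DD' /subsetP SS'.
  have step M' : M' \subset unplayed D' S' -> #|M'| <= b ->
      dominator_wins a b Dominator D' (S' :|: M').
    move=> /subsetP MU' cM'.
    have MU : M' :\: S \subset unplayed D S.
      apply/subsetP=> x; rewrite !inE => /andP[xS /MU'].
      rewrite !inE !negb_or xS andbT => /andP[+ _]; exact: contra (DD' x).
    have cM : #|M' :\: S| <= b.
      by apply: leq_trans cM'; apply/subset_leq_card/subsetDl.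
    have [M /subsetP MM lM] := legal_move_extend MU cM.
    apply: (IH M lM); first exact/subsetP.
    apply/subsetP=> x; rewrite !inE => /orP[/SS'-> //|xM].
    by have := MM x; rewrite !inE xM andbT; case: (_ \in S) => //= ->.
  have [U0'|/eqP U0'] := eqVneq (unplayed D' S') set0.
    have := step set0 (sub0set _); rewrite cards0 setU0 => /(_ isT).
    exact: wins_end.
  by apply: DW_Staller => // M [MU cM]; apply: step; rewrite // cM geq_minl.
Qed.

(** Dominator opens with an arbitrary legal move, a padding of the empty set; monotonicity does the
    rest. *)
Lemma wins_extra_move D S :
  dominator_wins a b Staller D S -> dominator_wins a b Dominator D S.
Proof.
have [U0|/eqP U0] := eqVneq (unplayed D S) set0; first exact: wins_end.
have [|M _ lM] := @legal_move_extend a D S set0 (sub0set _).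
  by rewrite cards0.
move=> w; apply: (DW_Dominator U0 lM).
exact: wins_mono (subsetUl _ _) (subxx _) w.
Qed.

End Game.

(** * Winners and thresholds as minima *)

Lemma winner_Dominator p G a b :
  (winner p G a b = Dominator) <-> @dominator_wins G a b p set0 set0.
Proof. by rewrite /winner; case: asboolP. Qed.

Lemma winner_W' G a b : 0 < a -> 0 < b ->
  W' G a b = Dominator -> W G a b = Dominator.
Proof.
move=> a0 b0 /winner_Dominator w.
exact/winner_Dominator/wins_extra_move.
Qed.

Lemma min_posP (P : nat -> Prop) :
  match min_pos P with
  | Some m => [/\ 0 < m, P m & forall n, 0 < n -> P n -> m <= n]
  | None => forall n, 0 < n -> ~ P n
  end.
Proof.
rewrite /min_pos; case: pselect => [exP|nexP].
  case: ex_minnP => m /andP[m0 /asboolP Pm] minm; split=> // n n0 Pn.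
  by apply: minm; rewrite n0; apply/asboolP.
by move=> n n0 Pn; apply: nexP; exists n; rewrite n0; apply/asboolP.
Qed.

Lemma le_inf_min_pos (P Q : nat -> Prop) :
  (forall n, 0 < n -> Q n -> P n) -> le_inf (min_pos P) (min_pos Q).
Proof.
move=> QP; have := min_posP P; have := min_posP Q.
case: (min_pos P) => [m|]; case: (min_pos Q) => [n|] //=.
  by move=> [n0 Qn _] [_ _]; apply=> //; apply: QP.
by move=> [n0 Qn _] /(_ n n0) []; apply: QP.
Qed.

Lemma min_pos_le_inf (P : nat -> Prop) n :
  0 < n -> P n -> le_inf (min_pos P) (Some n).
Proof.
move=> n0 Pn; have := min_posP P; case: (min_pos P) => [m [_ _]|] /=.
  exact.
by move=> /(_ n n0).
Qed.

Lemma le_inf_min_pos_lb (P : nat -> Prop) n :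
  (forall m, 0 < m -> P m -> n <= m) -> le_inf (Some n) (min_pos P).
Proof.
by move=> lbP; have := min_posP P; case: (min_pos P) => //= m [? ? _]; apply: lbP.
Qed.

(** * Orientations with all out-degrees at least [t] *)

Section Orientation.

Variable H : sgraph.
Implicit Type o : {set H * H}.

Definition orientation o :=
  forall u v, ((u, v) \in o) = adj u v && ((v, u) \notin o).

Definition out o v := [set w | (v, w) \in o].

Definition flip o x y := (y, x) |: (o :\ (x, y)).

(** Subtraction is truncated, so surpluses do not offset deficits: the value is zero iff every
    out-degree is at least [t]. *)
Definition deficit t o := \sum_v (t - #|out o v|).

Lemma ex_orientation : exists o, orientation o.
Proof.
exists [set p | adj p.1 p.2 && (enum_rank p.1 < enum_rank p.2)] => u v.
rewrite !inE /= (adj_sym v u); case: (boolP (adj u v)) => //= uv.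
rewrite -leqNgt ltn_neqAle andbC; case: leqP => //= _.
by apply/eqP=> /val_inj/enum_rank_inj E; rewrite E adj_irrefl in uv.
Qed.

Lemma orientation_neq o x y : orientation o -> (x, y) \in o -> x != y.
Proof.
by move=> oo; rewrite oo => /andP[xy _]; apply: contraL xy => /eqP->;
  rewrite adj_irrefl.
Qed.

Lemma orientation_flip o x y :
  orientation o -> (x, y) \in o -> orientation (flip o x y).
Proof.
move=> oo xy u v; have nxy := orientation_neq oo xy.
move: (xy); rewrite oo => /andP[axy yx].
have nyx : (y == x) = false by rewrite eq_sym (negPf nxy).
rewrite !inE !xpair_eqE.
have [/andP[/eqP-> /eqP->]|uv1] := boolP ((u == y) && (v == x)).
  by rewrite !eqxx nyx (negPf nxy) adj_sym axy.
have [/andP[/eqP-> /eqP->]|uv2] := boolP ((u == x) && (v == y)).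
  by rewrite !eqxx nyx (negPf nxy) /= andbF.
by rewrite (andbC (v == y)) (andbC (v == x)) (negPf uv1) (negPf uv2) /= oo.
Qed.

Lemma out_flip_tail o x y : orientation o -> (x, y) \in o ->
  #|out (flip o x y) x|.+1 = #|out o x|.
Proof.
move=> oo xy; have nxy := orientation_neq oo xy.
rewrite (cardsD1 y (out o x)) inE xy; congr _.+1.
apply: eq_card => w.
by rewrite !inE !xpair_eqE (negPf nxy) eqxx.
Qed.

Lemma out_flip_head o x y : orientation o -> (x, y) \in o ->
  #|out (flip o x y) y| = #|out o y|.+1.
Proof.
move=> oo xy; have nxy := orientation_neq oo xy.
have : x \notin out o y by rewrite inE; move: xy; rewrite oo => /andP[].
move=> xo; rewrite -[_.+1]/(true + _) -xo -cardsU1.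
apply: eq_card => w.
by rewrite !inE !xpair_eqE eqxx (eq_sym y x) (negPf nxy).
Qed.

Lemma out_flip_id o x y z : z != x -> z != y -> out (flip o x y) z = out o z.
Proof.
by move=> zx zy; apply/setP=> w; rewrite !inE !xpair_eqE (negPf zx) (negPf zy).
Qed.

(** The tail has a surplus, so losing an out-edge costs it nothing; the head's gain counts exactly
    when it was deficient. *)
Lemma deficit_flip t o x y : orientation o -> (x, y) \in o -> t < #|out o x| ->
  deficit t (flip o x y) + (#|out o y| < t) = deficit t o.
Proof.
move=> oo xy tx; have nxy := orientation_neq oo xy.
have nyx : y != x by rewrite eq_sym.
have split2 F : \sum_i F i = F x + (F y + \sum_(i | (i != x) && (i != y)) F i).
  by rewrite (bigD1 x) //= (bigD1 y nyx).
rewrite /deficit !split2.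
rewrite (eq_bigr (fun i => t - #|out o i|)); last first.
  by move=> i /andP[ix iy]; rewrite out_flip_id.
have := out_flip_tail oo xy; have := out_flip_head oo xy.
by case: ltnP; lia.
Qed.

(* Reversing the edges of the path one at a time, starting from the surplus
   vertex, moves the surplus along the path until it meets a deficient vertex. *)
Lemma path_decreases_deficit t o x p :
  orientation o -> path (fun u v => (u, v) \in o) x p -> uniq (x :: p) ->
  t < #|out o x| -> #|out o (last x p)| < t ->
  exists2 o', orientation o' & deficit t o' < deficit t o.
Proof.
elim: p o x => [|y p IHp] o x oo; first by rewrite /=; lia.
rewrite [path _ _ _]/= [last _ _]/= => /andP[xy yp].
rewrite cons_uniq => /andP[xyp uyp] tx vt.
have oo' := orientation_flip oo xy; have dE := deficit_flip oo xy tx.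
case: (ltnP #|out o y| t) => yt in dE *.
  by exists (flip o x y) => //; rewrite -dE; lia.
(* The surplus is now at [y]. The rest of the path survives the reversal, since [x] does not recur
   on it. *)
rewrite addn0 in dE; rewrite -dE; apply: (IHp _ y) => //.
- apply: (sub_in_path (P := mem (y :: p))) yp; last exact/allP.
  move=> u v up vp; rewrite !inE !xpair_eqE => ->.
  rewrite (_ : u == x = false) ?orbT //.
  by apply: contraNF xyp => /eqP<-.
- by rewrite out_flip_head // ltnS.
- rewrite out_flip_id //; first by apply: contraNneq xyp => <-; apply: mem_last.
  by apply: contraTneq vt => ->; rewrite -leqNgt.
Qed.

Lemma degree_orientation o v : orientation o ->
  degree v = #|out o v| + \sum_u ((u, v) \in o).
Proof.
move=> oo; rewrite /degree -(cardsID (out o v)); congr (_ + _).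
  by apply: eq_card => w; rewrite !inE oo; case: (adj v w).
rewrite -sum1_card big_mkcond; apply: eq_bigr => w _ /=.
by rewrite !inE (oo w v) (adj_sym w v); case: (_ \in o); case: (adj v w).
Qed.

(* Let v be deficient and R the set of vertices that reach v.  All edges into R
   start in R, so the total out-degree on R is at least the total in-degree;
   being half of the total degree or more, it is at least t|R|, and some vertex
   of R has a surplus. *)
Lemma ex_balanced_orientation t : (forall v : H, 2 * t <= degree v) ->
  exists2 o, orientation o & forall v, t <= #|out o v|.
Proof.
move=> deg; have [o0 oo0] := ex_orientation.
have [n] := ubnP (deficit t o0); elim: n o0 oo0 => // n IHn o oo ltn.
have [/forallP ?|] := boolP [forall v, t <= #|out o v|]; first by exists o.
rewrite negb_forall => /existsP[v]; rewrite -ltnNge => vt.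
pose e u w := (u, w) \in o; pose R := [set x | connect e x v].
suff [x xR tx] : exists2 x, x \in R & t < #|out o x|.
  move: xR; rewrite inE => /connectP[p0 /shortenP[p xp up _] vE].
  rewrite vE in vt.
  have [o' oo' lto'] := path_decreases_deficit oo xp up tx vt.
  by apply: (IHn o') => //; lia.
case: (boolP [exists x in R, t < #|out o x|]) => [/exists_inP//|/exists_inPn outR].
exfalso.
have vR : v \in R by rewrite inE connect0.
have : \sum_(x in R) #|out o x| < \sum_(x in R) t.
  rewrite (bigD1 v vR) [ltnRHS](bigD1 v vR) /= -addSn leq_add // leq_sum // => x /andP[xR _].
  by rewrite leqNgt outR.
have : \sum_(x in R) 2 * t <= \sum_(x in R) (#|out o x| + \sum_u e u x).
  by apply: leq_sum => x _; rewrite -degree_orientation.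
have -> : \sum_(x in R) 2 * t = 2 * \sum_(x in R) t by rewrite big_distrr.
rewrite big_split [X in _ <= X]/=.
suff : \sum_(x in R) \sum_u e u x <= \sum_(x in R) #|out o x| by lia.
apply: (@leq_trans (\sum_(x in R) \sum_(u in R) e u x)).
  apply: leq_sum => x; rewrite inE => xv.
  rewrite [leqRHS]big_mkcond leq_sum // => u _.
  case: ifP => // /negbT; rewrite inE; case eux: (e u x) => //.
  by rewrite (connect_trans (connect1 eux) xv).
rewrite exchange_big leq_sum // => x _.
rewrite -sum1_card [leqRHS]big_mkcond [leqLHS]big_mkcond leq_sum // => w _.
by rewrite [w \in out _ _]inE /e; case: ifP => // _; case: (_ \in o).
Qed.

Lemma line_edge (u v : H) : adj u v ->
  exists e : line_graph H, val e = [set u; v].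
Proof.
move=> uv; have uvE : [set u; v] \in edges H.
  by apply/imsetP; exists (u, v); rewrite ?inE.
by exists (exist (fun A => A \in edges H) _ uvE).
Qed.

(** Carries the orientation over to the vertices of the line graph, on which the game is played. *)
Lemma ex_balanced_tail t : (forall v : H, 2 * t <= degree v) ->
  exists tl hd : line_graph H -> H,
    [/\ forall e, val e = [set tl e; hd e], forall e, tl e != hd e &
        forall v, t <= #|[set e | tl e == v]|].
Proof.
move=> /ex_balanced_orientation[o oo outo].
have ex (e : line_graph H) : exists p, (p \in o) && (val e == [set p.1; p.2]).
  have /imsetP[[u v]] := valP e; rewrite inE /= => uv ->.
  have [uvo|uvo] := boolP ((u, v) \in o); first by exists (u, v); rewrite uvo /=.
  by exists (v, u); rewrite oo adj_sym uv uvo /= setUC.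
pose p e := xchoose (ex e); pose tl e := (p e).1; pose hd e := (p e).2.
have po e : (tl e, hd e) \in o.
  by rewrite -surjective_pairing; have /andP[] := xchooseP (ex e).
have valE e : val e = [set tl e; hd e].
  by have /andP[_ /eqP] := xchooseP (ex e).
exists tl, hd; split=> [//|e|v]; first exact: orientation_neq (po e).
apply: leq_trans (outo v) _.
(* The heads of the edges with tail [v] cover [out o v]. *)
apply: leq_trans (leq_imset_card hd _); apply/subset_leq_card/subsetP => w.
rewrite inE => vw; move: (vw); rewrite oo => /andP[avw wv].
have [e eE] := line_edge avw; have := po e.
have : tl e \in [set v; w] by rewrite -eE valE set21.
have : hd e \in [set v; w] by rewrite -eE valE set22.
rewrite !inE => /orP[] /eqP hE /orP[] /eqP tE; rewrite hE tE => vwo.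
- by have := orientation_neq oo vwo; rewrite eqxx.
- by rewrite vwo in wv.
- by apply/imsetP; exists e; rewrite ?inE ?tE.
- by have := orientation_neq oo vwo; rewrite eqxx.
Qed.

End Orientation.

Lemma min_degree_le (G : sgraph) (v : G) : min_degree G <= degree v.
Proof.
rewrite /min_degree; have : v \in index_enum G by rewrite mem_index_enum.
elim: (index_enum G) => // u s IHs; rewrite inE big_cons => /predU1P[<-|/IHs].
  exact: geq_minl.
by move=> le_s; apply: leq_trans le_s; apply: geq_minr.
Qed.

(** * Dominator's reply strategy on the line graph *)

Section Strategy.

Variables (H : sgraph) (t a b : nat).
Variables tl hd : line_graph H -> H.
Hypothesis valE : forall e, val e = [set tl e; hd e].
Hypothesis tl_neq_hd : forall e, tl e != hd e.
Hypothesis tailP : forall v, t <= #|[set e | tl e == v]|.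
Implicit Types (D S M N : {set line_graph H}) (u v : H) (e f : line_graph H).

Definition tail_star v := [set e | tl e == v].

Definition star v := [set e : line_graph H | v \in val e].

(** Edges are nonempty sets, so [d = e] is allowed: this is domination by closed neighborhoods. *)
Definition dominated D e := [exists d in D, val e :&: val d != set0].

Definition safe D S :=
  forall v, [disjoint tail_star v & S] \/ {in star v, forall e, dominated D e}.

Lemma tl_star e : e \in star (tl e).
Proof. by rewrite inE valE set21. Qed.

Lemma tail_star_sub v : tail_star v \subset star v.
Proof. by apply/subsetP=> e; rewrite inE => /eqP<-; apply: tl_star. Qed.

Lemma dominated_star D v e d :
  e \in star v -> d \in star v -> d \in D -> dominated D e.
Proof.
rewrite !inE => ve vd dD; apply/exists_inP; exists d => //.
by apply/set0Pn; exists v; rewrite inE ve.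
Qed.

Lemma dominated_sub D D' e : D \subset D' -> dominated D e -> dominated D' e.
Proof.
move=> /subsetP DD' /exists_inP[d /DD' dD' ed].
by apply/exists_inP; exists d.
Qed.

(** Apply safety at the tail of [e]: if Staller has nothing in its out-star, a full board puts [e]
    itself in [D]. *)
Lemma safe_dominating D S : safe D S -> unplayed D S = set0 -> dominating D.
Proof.
move=> sDS U0 e; have domDe : dominated D e.
  have [dis|] := sDS (tl e); last by apply; apply: tl_star.
  have eS : e \notin S by rewrite (disjointFr dis) // inE.
  have : e \notin unplayed D S by rewrite U0 inE.
  rewrite !inE negbK (negPf eS) orbF => eD.
  exact: dominated_star (tl_star e) (tl_star e) eD.
have [eD|eD] := boolP (e \in D); first by left.
right; have /exists_inP[d dD ed] := domDe; exists d => //.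
by rewrite /= /line_adj setIC ed andbT; apply: contraNneq eD => <-.
Qed.

(* The default e is claimed by Staller when replies are used, so it is junk there. *)
Definition pick_in (X : {set line_graph H}) e := odflt e [pick x in X].

Definition reply (U : {set line_graph H}) e :=
  if U :&: tail_star (tl e) != set0 then pick_in (U :&: tail_star (tl e)) e else
  if U :&: star (tl e) != set0 then pick_in (U :&: star (tl e)) e else
  pick_in (U :&: tail_star (hd e)) e.

Lemma pick_in_mem (X : {set line_graph H}) e : X != set0 -> pick_in X e \in X.
Proof.
rewrite /pick_in; case: pickP => //= X0 /set0Pn[x].
by have /= -> := X0 x.
Qed.

(** [N] need only contain the replies still unplayed, which leaves room for padding it to a legal
    move. *)
Lemma safe_reply D S M N : #|M| < 2 * t -> safe D S ->
  unplayed D (S :|: M) :&: reply (unplayed D (S :|: M)) @: M \subset N ->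
  safe (D :|: N) (S :|: M).
Proof.
set U := unplayed _ _ => cM sDS /subsetP repN u.
have [|ndis] := boolP [disjoint tail_star u & S :|: M]; first by left.
right=> e eu; have [disu|domu] := sDS u; last first.
  by apply: dominated_sub (domu e eu); apply: subsetUl.
apply: contraT => nd.
(* As [e] is undominated, Dominator owns no edge at either end of [e]. *)
have noD v f : e \in star v -> f \in star v -> f \notin D :|: N.
  by move=> ev fv; apply: contra nd; apply: dominated_star fv.
have repD f : f \in M -> reply U f \in U -> reply U f \in D :|: N.
  by move=> fM fU; rewrite inE [_ \in N]repN ?orbT // inE fU imset_f.
(* Safety at an end [v] of [e] means that Staller had nothing in its out-star; if no edge of it is
   left, all of it went in [M]. *)
have tail_sub v : e \in star v -> U :&: tail_star v = set0 -> tail_star v \subset M.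
  move=> ev Uv; have [dis|domv] := sDS v; last first.
    by case/negP: nd; apply: dominated_sub (domv e ev); apply: subsetUl.
  apply/subsetP=> x xv; have := noD v x ev (subsetP (tail_star_sub v) x xv).
  have : x \notin U :&: tail_star v by rewrite Uv inE.
  rewrite in_setI xv andbT !inE (disjointFr dis xv) /=.
  by case: (x \in D); case: (x \in M).
have [e0 e0u e0M] : exists2 e0, tl e0 = u & e0 \in M.
  have /pred0Pn[e0 /andP[]] := ndis; rewrite !inE => /eqP e0u /orP[e0S|]; last by exists e0.
  by have := disjointFl disu e0S; rewrite inE e0u eqxx.
(* Otherwise the reply to [e0] would lie at [u] and dominate [e]; the same holds for the full star
   below. *)
have uU : U :&: tail_star u = set0.
  apply/eqP; apply: contraT => U0.
  have := pick_in_mem e0 U0; have := repD e0 e0M; rewrite /reply e0u U0.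
  move=> rD /setIP[/rD + /(subsetP (tail_star_sub u)) /(noD u _ eu)].
  by move=> ->.
have usU : U :&: star u = set0.
  apply/eqP; apply: contraT => U0.
  have := pick_in_mem e0 U0; have := repD e0 e0M; rewrite /reply e0u uU eqxx U0 /=.
  by move=> rD /setIP[/rD + /(noD u _ eu)] => ->.
(* No edge at [u] is left unplayed, so [e] is Staller's; had she owned it earlier, safety at its
   tail would make it dominated. *)
have eM : e \in M.
  have := noD u e eu eu; have : e \notin U :&: star u by rewrite usU inE.
  rewrite in_setI eu andbT !inE; have [eS _ _|] := boolP (e \in S).
    have [dis|dome] := sDS (tl e).
      by have := disjointFl dis eS; rewrite inE eqxx.
    case/negP: nd; apply: dominated_sub (dome e (tl_star e)); exact: subsetUl.
  by case: (e \in D); case: (e \in M).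
(* [w] is the other end of [e]. If [u] is the tail, the first two options of the reply to [e] are
   void and the third is at the head; otherwise the first is at [w]. A reply there would dominate
   [e]. *)
have [w [wu ew Uw]] : exists w, [/\ w != u, e \in star w & U :&: tail_star w = set0].
  have := repD e eM; rewrite /reply.
  have [eE|neE] := eqVneq (tl e) u.
    rewrite eE uU usU eqxx /= => rD.
    have ehd : e \in star (hd e) by rewrite inE valE set22.
    exists (hd e); rewrite -eE eq_sym tl_neq_hd; split=> //.
    apply/eqP; apply: contraT => U0; have := pick_in_mem e U0.
    move=> /setIP[/rD + /(subsetP (tail_star_sub _)) /(noD _ _ ehd)].
    by move=> ->.
  move=> rD; exists (tl e); rewrite neE tl_star; split=> //.
  apply/eqP; apply: contraT => U0; move: rD; have := pick_in_mem e U0; rewrite U0.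
  move=> /setIP[+ /(subsetP (tail_star_sub _)) /(noD _ _ (tl_star e))].
  by move=> rU nD /(_ rU) rD; rewrite rD in nD.
have disuw : [disjoint tail_star u & tail_star w].
  by apply/pred0P=> f /=; rewrite !inE; case: eqVneq => //= ->; rewrite eq_sym (negPf wu).
(* Two disjoint out-stars inside [M] give at least [2 * t] edges, too many for one move. *)
have : #|tail_star u :|: tail_star w| <= #|M|.
  by apply: subset_leq_card; rewrite subUset !tail_sub.
rewrite cardsU; move: disuw; rewrite -setI_eq0 => /eqP->; rewrite cards0.
have tP v : t <= #|tail_star v| := tailP v.
by have := tP u; have := tP w; lia.
Qed.

Lemma safe_wins D S : 0 < a -> 0 < b -> b <= a -> b < 2 * t -> safe D S ->
  dominator_wins a b Staller D S.
Proof.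
move=> a0 b0 ba bt; have [n] := ubnP #|unplayed D S|.
elim: n D S => // n IHn D S ltn sDS.
have [U0|/eqP U0] := eqVneq (unplayed D S) set0.
  by apply: DW_end => //; apply: safe_dominating sDS U0.
apply: DW_Staller => // M lM; have [MU cM] := lM.
have cMb : #|M| <= b by rewrite cM geq_minl.
set U := unplayed D (S :|: M).
(* There is at most one reply per edge of [M], so [b <= a] lets Dominator play them all. *)
have [|N PN lN] := @legal_move_extend _ a D (S :|: M)
  (U :&: reply U @: M) (subsetIl _ _).
  apply: leq_trans (subset_leq_card (subsetIr _ _)) _.
  by apply: leq_trans (leq_imset_card _ _) _; lia.
have sDS' : safe (D :|: N) (S :|: M) by apply: safe_reply => //; lia.
have ltU : #|U| < #|unplayed D S|.
  by rewrite /U unplayedUr; apply: legal_move_decr lM.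
have [V0|/eqP V0] := eqVneq U set0.
  move: lN sDS' => [+ _]; rewrite -/U V0 subset0 => /eqP->; rewrite setU0 => s'.
  by apply: DW_end => //; apply: safe_dominating s' V0.
apply: (DW_Dominator V0 lN); apply: IHn => //.
rewrite unplayedUl; apply: leq_ltn_trans (subset_leq_card (subsetDl _ _)) _.
by rewrite -/U; lia.
Qed.

End Strategy.

(** * Threshold bounds for line graphs *)

(** The case [b = k] bounds [thr_a'] from above; all [b <= k] together bound [thr_b'] from below. *)
Lemma line_graph_W' t k b (H : sgraph) : 0 < b -> b <= k -> k <= 2 * t - 1 ->
  2 * t <= min_degree H -> W' (line_graph H) k b = Dominator.
Proof.
move=> b0 bk kt mdeg; apply/winner_Dominator.
have [|tl [hd [valE tlhd tlP]]] := @ex_balanced_tail H t.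
  by move=> v; apply: leq_trans mdeg (min_degree_le v).
apply: (safe_wins valE tlhd tlP); rewrite //; try lia.
by move=> v; left; rewrite -setI_eq0 setI0.
Qed.

Theorem theorem11 (t k : nat) (H : sgraph) (ht : 0 < t) (hk : 0 < k)
    (hkt : k <= 2 * t - 1) (hdeg : 2 * t <= min_degree H) :
  [/\ le_inf (thr_a k (line_graph H)) (thr_a' k (line_graph H)),
      le_inf (thr_a' k (line_graph H)) (Some k),
      le_inf (thr_b' k (line_graph H)) (thr_b k (line_graph H)) &
      le_inf (Some k.+1) (thr_b' k (line_graph H))].
Proof.
split.
- by apply: le_inf_min_pos => n n0; apply: winner_W'.
- by apply: min_pos_le_inf => //; apply: (@line_graph_W' t).
- apply: le_inf_min_pos => n n0 WS; case W'E: (W' _ _ _) => //.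
  by rewrite (winner_W' hk n0 W'E) in WS.
- apply: le_inf_min_pos_lb => b b0; apply: contraPT; rewrite -leqNgt => bk.
  by rewrite (line_graph_W' b0 bk hkt hdeg).
Qed.
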